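(* Let $d$ be the Hamming distance on $\{0,1\}^m$, let $\mathcal{C}_{\mathrm{mon}}^m$ be the class of monomials and $\mathcal{C}_{\mathrm{claus}}^m$ the class of clauses over the Boolean variables $v_1,\dots,v_m$. Then $$\mathcal{S}_{\mathrm{CS}^d_{\min}}(\mathcal{C}_{\mathrm{mon}}^m\cup\mathcal{C}_{\mathrm{claus}}^m)=2 .$$
   Context: Concepts over $\mathcal{X}=\{0,1\}^m$ are Boolean functions $\{0,1\}^m\to\{0,1\}$; a concept class is a set of concepts. $\mathcal{C}_{\mathrm{mon}}^m$ consists of all functions that are conjunctions of literals from $v_1,\bar v_1,\dots,v_m,\bar v_m$ in which each variable occurs at most once (negated or not); the empty monomial is the constant-1 function (the constant-0 function is not in the class). $\mathcal{C}_{\mathrm{claus}}^m$ consists of all functions that are disjunctions of literals in which each variable occurs at most once; the empty clause is the constant-0 function (the constant-1 function is not in this class). Minimum distance model. For $x\in\mathcal{X}$ and a concept $C$, let $\mathrm{CS}^d_{\min}(x,C)$ be the set of all $x'\in\mathcal{X}$ with $C(x')\ne C(x)$ that minimize $d(x,x')$ among all points of $\mathcal{X}$ whose label differs from $C(x)$ (empty if no such point exists). Learning with contrast sets. Let $\mathrm{CS}$ assign to each pair $(x,C)$ a subset of $\mathcal{X}$. A learner, who knows $\mathcal{C}$ and $\mathrm{CS}$, tries to identify an unknown $C^*\in\mathcal{C}$. The initial version space is $\mathcal{C}_1=\mathcal{C}$. In round $i\ge1$ the learner, depending on all previous queries and responses, chooses $x_i\in\mathcal{X}$. The oracle returns $y_i=C^*(x_i)$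 and, if $\mathrm{CS}(x_i,C^* )\neq\emptyset$, a pair $(x_i',y_i')$ where $x'_i\in\mathrm{CS}(x_i,C^* )$ is chosen adversarially and $y'_i=C^*(x_i')$; if $\mathrm{CS}(x_i,C^* )=\emptyset$ it returns $y_i$ and a dummy symbol $\omega$. The new version space $\mathcal{C}_{i+1}$ consists of all $C\in\mathcal{C}_i$ with $C(x_i)=y_i$ and, if $\omega$ was returned, $\mathrm{CS}(x_i,C)=\emptyset$, and otherwise $C(x'_i)=y'_i$ and $x'_i\in\mathrm{CS}(x_i,C)$. The sequence of queries, responses and version spaces of the first $n$ rounds is an interaction sequence of length $n$; it identifies $C^*$ if $\mathcal{C}_{n+1}=\{C^*\}$. For a learner $L$, $\mathcal{S}_{\mathrm{CS}}(L,C^*,\mathcal{C})$ is the largest length of any valid interaction sequence that identifies $C^*$ and in which $L$ chooses the queries (worst case over the oracle's choices of the $x_i'$), i.e. the worst-case number of rounds $L$ uses to identify $C^*$; $\mathcal{S}_{\mathrm{CS}}(L,\mathcal{C})=\sup_{C^*\in\mathcal{C}}\mathcal{S}_{\mathrm{CS}}(L,C^*,\mathcal{C})$ and $\mathcal{S}_{\mathrm{CS}}(\mathcal{C})=\inf_L\mathcal{S}_{\mathrm{CS}}(L,\mathcal{C})$.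
   Formalization: The number m of Boolean variables is assumed to be at least 2; for m = 0 and m = 1 the claimed equality fails, since a single query already identifies every concept and the value is 1. *)

(* Defs.v *)
From HB Require Import structures.
From mathcomp Require Import all_boot all_order all_algebra.
From mathcomp Require Import classical_sets reals constructive_ereal ereal.

Set Implicit Arguments.
Unset Strict Implicit.
Unset Printing Implicit Defensive.

Section ContrastSetLearning.
Variable X : finType.

Definition concept := {ffun X -> bool}.

(* (y, Some (x', y')) : label of the query plus a labelled contrast example;
   (y, None) : label of the query plus the dummy symbol omega. *)
Definition response : Type := bool * option (X * bool).

Definition history := seq (X * response).

Definition learner := history -> X.

Variable CS : X -> concept -> {set X}.

(* [answers C x r]: r is a response that an oracle with target C may give to
   the query x.  The same condition, read with a fixed response and a varying
   C, is the one by which version spaces are updated. *)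
Definition answers (C : concept) (x : X) (r : response) : bool :=
  (r.1 == C x) &&
  match r.2 with
  | Some (x', y') => (x' \in CS x C) && (y' == C x')
  | None => CS x C == finset.set0
  end.

(* The version space after the rounds recorded in h, oldest round first. *)
Definition version_space (CC : {set concept}) (h : history) : {set concept} :=
  foldl (fun (V : {set concept}) q => [set C in V | answers C q.1 q.2]) CC h.

Definition interaction_sequence (L : learner) (Cst : concept) (h : history) :=
  forall h1 x r h2, h = h1 ++ (x, r) :: h2 -> x = L h1 /\ answers Cst x r.

Definition identifies (CC : {set concept}) (Cst : concept) (h : history) :=
  version_space CC h = [set Cst].

(* An unending interaction: all of its initial segments are interaction
   sequences.  As the oracle always has some admissible response, every
   interaction sequence is an initial segment of such a play. *)
Definition valid_play (L : learner) (Cst : concept) (p : nat -> X * response) :=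
  forall n, interaction_sequence L Cst (mkseq p n).

Variable R : realType.

(* The length of the shortest initial segment of p that identifies Cst
   (the interaction stops once Cst is identified); +oo if there is none. *)
Definition play_rounds (CC : {set concept}) (Cst : concept)
    (p : nat -> X * response) : \bar R :=
  ereal_inf [set (n%:R)%:E | n in
    [set n | identifies CC Cst (mkseq p n)]]%classic.

(* Worst case over the choices of the oracle; in particular +oo if some of
   them prevent L from ever identifying Cst. *)
Definition target_complexity (L : learner) (Cst : concept)
    (CC : {set concept}) : \bar R :=
  ereal_sup [set play_rounds CC Cst p | p in
    [set p | valid_play L Cst p]]%classic.

Definition learner_complexity (L : learner) (CC : {set concept}) : \bar R :=
  ereal_sup [set target_complexity L Cst CC | Cst in
    [set Cst | Cst \in CC]]%classic.

Definition sample_complexity (CC : {set concept}) : \bar R :=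
  ereal_inf [set learner_complexity L CC | L in [set: learner]]%classic.

End ContrastSetLearning.

Section MinimumDistance.
Variables (X : finType) (d : X -> X -> nat).

Definition CSmin (x : X) (C : concept X) : {set X} :=
  [set x' | (C x' != C x) &&
            [forall z, (C z != C x) ==> (d x x' <= d x z)]].

End MinimumDistance.

Section BooleanClasses.
Variable m : nat.

Definition cube := {ffun 'I_m -> bool}.

Definition hamming (x y : cube) : nat := #|[set i | x i != y i]|.

(* A set of literals in which each variable occurs at most once: at i,
   [Some true] stands for v_i, [Some false] for its negation, and [None] for
   neither of the two. *)
Definition literals := {ffun 'I_m -> option bool}.

Definition monomial (l : literals) : concept cube :=
  [ffun x : cube => [forall i, if l i is Some b then x i == b else true]].

Definition clause (l : literals) : concept cube :=
  [ffun x : cube => [exists i, if l i is Some b then x i == b else false]].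

Definition Cmon : {set concept cube} := [set monomial l | l : literals].

Definition Cclaus : {set concept cube} := [set clause l | l : literals].

End BooleanClasses.

(* Main.v *)
(** Inclusion-minimality of minimum-distance contrast examples determines them:
    a monomial [C] with [C x = 0] has as its only closest contrast the point
    obtained from [x] by repairing all violated literals, while for [C x = 1] a
    contrast flips exactly one literal of [C]; clauses are dual, by negating
    labels.  Two rounds suffice: after any query [x] with contrast [x'], query
    the complement [z] of [x'].  Say [C x = 1].  If [C z = 0], then [C] is a
    monomial whose variables are those where the second contrast agrees with
    [x]; if [C z = 1], then [C] is the clause made of the literals of [z] flipped
    by the second contrast.  One round is not enough: to a query [x], the literal
    of [v_1] satisfied by [x], and its conjunction with the literal of [v_2]
    satisfied by [x], admit the same response. *)

Require Import Defs.
From mathcomp Require Import all_boot all_order all_algebra.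
From mathcomp Require Import classical_sets reals constructive_ereal ereal.

Set Implicit Arguments.
Unset Strict Implicit.
Unset Printing Implicit Defensive.

(** * Plays against an arbitrary contrast oracle *)

Section Interaction.
Variables (X : finType) (CS : X -> concept X -> {set X}).
Implicit Types (C : concept X) (CC : {set concept X}) (h : history X).

Lemma in_version_space CC h C :
  (C \in version_space CS CC h) =
  (C \in CC) && all (fun q => answers CS C q.1 q.2) h.
Proof.
rewrite /version_space; elim: h CC => [|q h IH] CC /=; first by rewrite andbT.
by rewrite IH inE andbA.
Qed.

(** Turns a split of an initial segment into an index of the play, so that validity can be checked
    round by round. *)
Lemma mkseq_eq_cat (T : Type) (p : nat -> T) n (h1 : seq T) a (h2 : seq T) :
  mkseq p n = h1 ++ a :: h2 -> h1 = mkseq p (size h1) /\ a = p (size h1).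
Proof.
move=> e.
have sn : size h1 < n.
  by rewrite -(size_mkseq p n) e size_cat /= addnS ltnS leq_addr.
split.
  have t : take (size h1) (mkseq p n) = h1 by rewrite e take_size_cat.
  by rewrite -[LHS]t /mkseq -map_take take_iota (minn_idPl (ltnW sn)).
by rewrite -(nth_mkseq a p sn) e nth_cat ltnn subnn.
Qed.

Lemma valid_play_step (L : learner X) C p n :
  valid_play CS L C p ->
  (p n).1 = L (mkseq p n) /\ answers CS C (p n).1 (p n).2.
Proof.
move=> /(_ n.+1) hp.
have e : mkseq p n.+1 = mkseq p n ++ ((p n).1, (p n).2) :: [::].
  by rewrite mkseqS -cats1; case: (p n).
exact: hp e.
Qed.

Lemma valid_playP (L : learner X) C p :
  (forall n, (p n).1 = L (mkseq p n) /\ answers CS C (p n).1 (p n).2) ->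
  valid_play CS L C p.
Proof.
move=> hp n h1 x r h2 e; have [e1 e2] := mkseq_eq_cat e.
by have := hp (size h1); rewrite -e2 -e1.
Qed.

(** Runs [L] against a memoryless oracle [f]; the histories are built by recursion. It supplies the
    adversary of the lower bound. *)
Lemma valid_play_ex (L : learner X) C (f : X -> response X) :
  (forall x, answers CS C x (f x)) ->
  exists2 p, valid_play CS L C p & forall n, (p n).2 = f (p n).1.
Proof.
move=> hf.
pose hist := fix hist n := if n is k.+1 then
  rcons (hist k) (L (hist k), f (L (hist k))) else [::].
pose p n := (L (hist n), f (L (hist n))).
have pE n : mkseq p n = hist n by elim: n => // n IH; rewrite mkseqS IH.
by exists p => //; apply: valid_playP => n; rewrite pE.
Qed.

End Interaction.

(** * Closest contrasts in the Boolean cube *)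

Section MinimumDistance.
Variable m : nat.
Notation cube := (cube m).
Notation CS := (CSmin (@hamming m)).
Implicit Types (C : concept cube) (x z w : cube) (l : literals m).

Definition flip x (i : 'I_m) : cube := [ffun j => (j == i) (+) x j].

Definition compl x : cube := [ffun j => ~~ x j].

Definition negc C : concept cube := [ffun x => ~~ C x].

Definition negl l : literals m := [ffun i => omap negb (l i)].

Lemma negcK : involutive negc.
Proof. by move=> C; apply/ffunP => x; rewrite !ffunE negbK. Qed.

Lemma CSmin_negc x C : CS x (negc C) = CS x C.
Proof.
have e a b : (~~ a != ~~ b) = (a != b) by case: a; case: b.
apply/finset.setP => w; rewrite !inE !ffunE e; congr andb.
by apply: eq_forallb => z; rewrite !ffunE e.
Qed.

Lemma monomialP l w :
  reflect (forall i b, l i = Some b -> w i = b) (monomial l w).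
Proof.
rewrite ffunE; apply: (iffP forallP) => h i.
  by move=> b e; have := h i; rewrite e => /eqP.
by case e: (l i) => [b|] //; rewrite (h _ _ e).
Qed.

Lemma negc_monomial l : negc (monomial l) = clause (negl l).
Proof.
apply/ffunP => w; rewrite !ffunE negb_forall; apply: eq_existsb => i.
by rewrite !ffunE; case: (l i) => [b|] //=; case: (w i); case: b.
Qed.

Lemma neglK : involutive negl.
Proof.
by move=> l; apply/ffunP => i; rewrite !ffunE; case: (l i) => [b|] //=; rewrite negbK.
Qed.

Lemma clauseE l : clause l = negc (monomial (negl l)).
Proof. by rewrite negc_monomial neglK. Qed.

Lemma in_class_negc C :
  (C \in Cmon m :|: Cclaus m) -> (negc C \in Cmon m :|: Cclaus m).
Proof.
rewrite !inE => /orP[/imsetP[l _ ->]|/imsetP[l _ ->]].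
  by rewrite negc_monomial [X in _ || X]imset_f ?orbT.
by rewrite clauseE negcK imset_f.
Qed.

Lemma CSmin_neq x C w : w \in CS x C -> C w != C x.
Proof. by rewrite inE => /andP[]. Qed.

Lemma CSmin_exists x C w : C w != C x -> CS x C != finset.set0.
Proof.
move=> hw; apply/finset.set0Pn.
case: (@arg_minnP _ w (fun z => C z != C x) (@hamming m x)) => // v hv hmin.
by exists v; rewrite inE hv; apply/forallP => z; apply/implyP/hmin.
Qed.

(** The coordinates where [w] leaves [x] are among those where [x'] does, and by minimality of [x']
    there are at least as many. So the two sets coincide, and on Boolean coordinates such a set
    determines the point. *)
Lemma CSmin_minimal x C x' w :
  x' \in CS x C -> C w != C x -> (forall j, w j != x j -> w j = x' j) -> x' = w.
Proof.
rewrite inE => /andP[_ /forallP/(_ w)/implyP h] /h le_d hw.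
have sub : [set i | x i != w i] \subset [set i | x i != x' i].
  apply/fintype.subsetP => j; rewrite !inE => ne.
  by rewrite -hw // eq_sym.
have /eqP/finset.setP e : [set i | x i != w i] == [set i | x i != x' i].
  by rewrite eqEcard sub.
apply/ffunP => j; have := e j; rewrite !inE.
by have := hw j; case: (x j); case: (w j); case: (x' j) => // ->.
Qed.

(** A different label forces a different point, so distance 1 is the least possible. *)
Lemma flip_CSmin x C i : C (flip x i) != C x -> flip x i \in CS x C.
Proof.
move=> ne; rewrite inE ne /=; apply/forallP => w; apply/implyP => hw.
have -> : hamming x (flip x i) = 1.
  rewrite /hamming -(cards1 i); apply: eq_card => j; rewrite !inE ffunE.
  by case: (j == i); case: (x j).
rewrite /hamming card_gt0; apply: contra hw => /eqP/finset.setP e.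
suff -> : w = x by [].
by apply/ffunP => j; have := e j; rewrite !inE => /negbFE/eqP.
Qed.

Lemma CSmin_monomial0 l x x' : x' \in CS x (monomial l) -> ~~ monomial l x ->
  x' = [ffun j => odflt (x j) (l j)].
Proof.
move=> hx' hx; apply: (CSmin_minimal hx').
  rewrite (negbTE hx); have -> // : monomial l [ffun j => odflt (x j) (l j)].
  by apply/monomialP => j b e; rewrite ffunE e.
have := CSmin_neq hx'; rewrite (negbTE hx); case: monomialP => // h _ j.
rewrite ffunE; case e: (l j) => [b|] /=; last by rewrite eqxx.
by rewrite (h _ _ e).
Qed.

Lemma CSmin_monomial1 l x x' : x' \in CS x (monomial l) -> monomial l x ->
  exists2 i, l i = Some (x i) & x' = flip x i.
Proof.
move=> hx' hx; have := CSmin_neq hx'; rewrite hx eqb_id ffunE negb_forall.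
move=> /existsP[i]; case e: (l i) => [b|] // hi.
have xi : x i = b by move/monomialP: hx => /(_ _ _ e).
(* The literal at [i] is one that [x'] violates; flipping it alone already changes the label. *)
exists i; first by rewrite xi.
apply: (CSmin_minimal hx').
  rewrite hx eqb_id; apply/negP => /monomialP/(_ _ _ e).
  by rewrite ffunE eqxx xi; case: (b).
move=> j; rewrite ffunE; case: (j =P i) => [->|_] /=; last by rewrite eqxx.
by move=> _; move: hi; rewrite xi; case: (b); case: (x' i).
Qed.

Lemma CSmin_clause1 l x x' : x' \in CS x (clause l) -> clause l x ->
  x' = [ffun j => if l j is Some b then ~~ b else x j].
Proof.
rewrite clauseE CSmin_negc ffunE => /CSmin_monomial0 h /h ->.
by apply/ffunP => j; rewrite !ffunE; case: (l j).
Qed.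

(** * Reconstruction of the target from two rounds *)

Definition decode x (y : bool) z z' : concept cube :=
  [ffun w : cube => if y then [exists j, (z' j != z j) && (w j == z j)]
             else [forall j, (z' j == x j) ==> (w j == x j)]].

(** Both branches of [decode] serve monomials: one that is true at the second query has a single
    literal, hence is also a clause. *)
Lemma decodeE C x x' z' : C \in Cmon m :|: Cclaus m -> C x ->
  x' \in CS x C -> z' \in CS (compl x') C ->
  C = decode x (C (compl x')) (compl x') z'.
Proof.
rewrite inE => /orP[/imsetP[l _ ->]|/imsetP[l _ ->]] hx hx' hz'.
- have [i li ex'] := CSmin_monomial1 hx' hx.
  have lx : forall j b, l j = Some b -> x j = b by apply/monomialP.
  (* The second query agrees with [x] at [i] only. *)
  have zE j : compl x' j = (j != i) (+) x j.
    by rewrite ex' !ffunE; case: (j == i); case: (x j).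
  case: (boolP (monomial l (compl x'))) => hz.
  + have lN j : j != i -> l j = None.
      move=> ji; case e: (l j) => [b|] //.
      move/monomialP: hz => /(_ _ _ e); rewrite zE ji (lx _ _ e).
      by case: (b).
    have [k lk ->] := CSmin_monomial1 hz' hz.
    have ki : k = i by apply/eqP/negPn/negP => /lN; rewrite lk.
    subst k; apply/ffunP => w; rewrite [RHS]ffunE.
    apply/monomialP/existsP => [h|[j] /andP[hj /eqP wj] k b e].
      by exists i; rewrite (h _ _ lk) eqxx ffunE eqxx; case: (compl x' i).
    have ji : j = i.
      by apply/eqP; move: hj; rewrite ffunE; case: (j == i); rewrite ?eqxx.
    have ki : k = i by apply/eqP/negPn/negP => /lN; rewrite e.
    by move: e; rewrite ki lk -ji wj => -[].
  (* The repair restores [x] on the variables of [l]; any other variable differs from [i] and keeps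
     the value opposite to [x]. *)
  + have ez' := CSmin_monomial0 hz' hz.
    apply/ffunP => w; rewrite [RHS]ffunE.
    apply/monomialP/forallP => h j.
      apply/implyP; rewrite ez' ffunE; case e: (l j) => [b|] /=.
        by rewrite (h _ _ e).
      rewrite zE; have -> : j != i by apply: contra_eq_neq e => ->; rewrite li.
      by case: (x j).
    move=> b e; move/implyP: (h j); rewrite ez' ffunE e /= (lx _ _ e) eqxx.
    by move=> /(_ isT)/eqP.
- have ex' := CSmin_clause1 hx' hx.
  (* As [x'] falsifies every literal of the clause, its complement satisfies them all, and the
     second contrast flips exactly these. *)
  have zE j : compl x' j = if l j is Some b then b else ~~ x j.
    by rewrite ex' !ffunE; case: (l j) => // b; rewrite negbK.
  have hz : clause l (compl x').
    move: hx; rewrite !ffunE => /existsP[j hj]; apply/existsP; exists j.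
    by move: hj; rewrite zE; case: (l j).
  rewrite hz; have ez' := CSmin_clause1 hz' hz.
  apply/ffunP => w; rewrite !ffunE; apply: eq_existsb => j.
  rewrite ez' [in X in _ = X && _]ffunE zE; case: (l j) => [b|]; last by rewrite eqxx.
  by case: b.
Qed.

Lemma two_rounds_inj C C' x x' z' :
  C \in Cmon m :|: Cclaus m -> C' \in Cmon m :|: Cclaus m ->
  C x = C' x -> x' \in CS x C -> x' \in CS x C' ->
  C (compl x') = C' (compl x') ->
  z' \in CS (compl x') C -> z' \in CS (compl x') C' -> C = C'.
Proof.
move=> hC hC' ex hx hx' ez hz hz'.
case: (boolP (C x)) => Cx.
  have Cx' : C' x by rewrite -ex.
  by rewrite (decodeE hC Cx hx hz) (decodeE hC' Cx' hx' hz') ez.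
(* If the label at [x] is 0, the negated concepts are decoded instead: they lie in the class and
   have the same contrast sets. *)
apply: (can_inj negcK).
have Cx' : negc C' x by rewrite ffunE -ex.
have {}Cx : negc C x by rewrite ffunE.
rewrite -CSmin_negc in hx; rewrite -CSmin_negc in hx'.
rewrite -CSmin_negc in hz; rewrite -CSmin_negc in hz'.
rewrite (decodeE (in_class_negc hC) Cx hx hz).
by rewrite (decodeE (in_class_negc hC') Cx' hx' hz') !ffunE ez.
Qed.

(** * A learner that needs at most two rounds *)

Lemma CSmin_eq0 x C : CS x C = finset.set0 -> C = [ffun=> C x].
Proof.
move=> e; apply/ffunP => w; rewrite ffunE; apply/eqP/negPn/negP.
by move/CSmin_exists; rewrite e eqxx.
Qed.

(** The head of the history is the first round. The all-true point is an arbitrary default, for the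
    first query and after an initial dummy symbol. *)
Definition compl_learner : learner cube := fun h =>
  if h is (_, (_, Some (x', _))) :: _ then compl x' else [ffun=> true].

Lemma compl_learner_identifies C p :
  C \in Cmon m :|: Cclaus m -> valid_play CS compl_learner C p ->
  identifies CS (Cmon m :|: Cclaus m) C (mkseq p 2).
Proof.
move=> hC hp; have [_ a0] := valid_play_step 0 hp.
have [q1 a1] := valid_play_step 1 hp.
apply/finset.setP => C'; rewrite in_version_space finset.in_set1.
apply/andP/eqP => [[hC']|-> //]; last by rewrite /= a0 a1.
rewrite /= andbT => /andP[]; move: a0 a1 q1; rewrite /= /mkseq /=.
case: (p 0) => x [y [[x' y']|]] /=; last first.
  (* A dummy symbol in the first round means that the target is constant, and the label tells which
     constant. *)
  rewrite /answers /= => /andP[/eqP -> /eqP e] _ _.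
  move=> /andP[/eqP e1 /eqP e'] _.
  by rewrite (CSmin_eq0 e) (CSmin_eq0 e') e1.
case: (p 1) => z [u [[z' u']|]] /=; rewrite /answers /=.
  move=> /andP[/eqP -> /andP[hx' _]] /andP[/eqP -> /andP[hz' _]] ez.
  rewrite ez in hz' *.
  move=> /andP[/eqP e /andP[kx' _]] /andP[/eqP f /andP[kz' _]].
  exact: (two_rounds_inj hC' hC (esym e) kx' hx' (esym f) kz' hz').
(* A dummy symbol in the second round would make [C] constant, against the contrast [x']. *)
move=> /andP[_ /andP[hx' _]] /andP[_ /eqP e].
by have := CSmin_neq hx'; rewrite (CSmin_eq0 e) !ffunE eqxx.
Qed.

(** * No learner succeeds with one round *)

Lemma one_round_not_identifies (L : learner cube) : 1 < m ->
  exists C p, [/\ C \in Cmon m :|: Cclaus m, valid_play CS L C p &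
    forall n, identifies CS (Cmon m :|: Cclaus m) C (mkseq p n) -> 1 < n].
Proof.
move=> hm; pose i0 := Ordinal (ltnW hm); pose i1 := Ordinal hm.
(* The first query does not depend on the target, so both targets may be tailored to it. *)
pose x := L [::].
pose l1 : literals m := [ffun i => if i == i0 then Some (x i) else None].
pose l2 : literals m :=
  [ffun i => if (i == i0) || (i == i1) then Some (x i) else None].
have mon1E w : monomial l1 w = (w i0 == x i0).
  apply/monomialP/eqP => [h|e i b]; first by apply: h; rewrite ffunE eqxx.
  by rewrite ffunE; case: eqP => // -> [<-].
have mon2x : monomial l2 x by apply/monomialP => i b; rewrite ffunE; case: ifP => // _ [].
have mon2f i : (i == i0) || (i == i1) -> monomial l2 (flip x i) = false.
  move=> hi; apply/negP => /monomialP/(_ i (x i)).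
  by rewrite !ffunE hi eqxx => /(_ erefl); case: (x i).
have mem l : monomial l \in Cmon m :|: Cclaus m by rewrite inE imset_f.
have ne : monomial l1 != monomial l2.
  apply/eqP => /ffunP/(_ (flip x i1)); rewrite mon1E mon2f ?eqxx ?orbT //.
  by rewrite ffunE eqxx.
(* The oracle always flips [i0], the only variable of [l1]. At [x] this flip changes the label of
   [l2] as well, so [l2] survives the first round. *)
have hf z : answers CS (monomial l1) z
    (monomial l1 z, Some (flip z i0, monomial l1 (flip z i0))).
  rewrite /answers /= !eqxx andbT flip_CSmin // !mon1E ffunE eqxx.
  by case: (z i0); case: (x i0).
have [p hp pf] := valid_play_ex L hf.
exists (monomial l1), p; split=> // n /finset.setP/(_ (monomial l2)).
rewrite in_version_space mem finset.in_set1 eq_sym (negbTE ne).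
case: n => [|[|n]] //=; rewrite andbT.
have [ep _] := valid_play_step 0 hp.
rewrite pf ep -/x /answers /= mon2x !mon1E ffunE eqxx /=.
rewrite flip_CSmin !mon2f ?mon2x ?eqxx //.
by case: (x i0).
Qed.

End MinimumDistance.

Theorem theorem7 (R : realType) (m : nat) (hm : 1 < m) :
  sample_complexity (CSmin (@hamming m)) R (Cmon m :|: Cclaus m) = (2%:R%:E)%E.
Proof.
apply: Order.POrderTheory.le_anti; apply/andP; split.
  apply: (@Order.POrderTheory.le_trans _ _
    (learner_complexity (CSmin (@hamming m)) R (@compl_learner m)
       (Cmon m :|: Cclaus m))).
    by apply: ereal_inf_lbound; exists (@compl_learner m).
  apply: ge_ereal_sup => _ [C hC <-].
  apply: ge_ereal_sup => _ [p hp <-].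
  apply: ereal_inf_lbound; exists 2 => //.
  exact: compl_learner_identifies.
apply: le_ereal_inf_tmp => _ [L _ <-].
have [C [p [hC hp hn]]] := one_round_not_identifies L hm.
(* The suprema are bounded below by the one bad target [C] and the one bad play [p]. *)
apply: (@Order.POrderTheory.le_trans _ _
  (target_complexity (CSmin (@hamming m)) R L C (Cmon m :|: Cclaus m))); last first.
  by apply: ereal_sup_ubound; exists C.
apply: (@Order.POrderTheory.le_trans _ _
  (play_rounds (CSmin (@hamming m)) R (Cmon m :|: Cclaus m) C p)); last first.
  by apply: ereal_sup_ubound; exists p.
apply: le_ereal_inf_tmp => _ [n /hn n2 <-].
by rewrite lee_fin Num.Theory.ler_nat.
Qed.
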